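(* Let $f:X\to Y$ be a map between schemes. Then $f$ is unramified if and only if its differentials are injective, i.e. for all $x:X$ the map $df_x:T_x(X)\to T_{f(x)}(Y)$ is injective.
   Context: We work in homotopy type theory with univalent universes and propositional truncation (neither excluded middle nor the axiom of choice is assumed). ''Merely'', ''there exists'' and disjunction refer to propositional truncation; a map is surjective if its fibers are merely inhabited. Fix a commutative ring $R$. A finitely presented $R$-algebra is one merely of the form $R[X_1,\dots,X_n]/(P_1,\dots,P_l)$; for such $A$, $\mathrm{Spec}(A)$ is the type of $R$-algebra homomorphisms $A\to R$, and for $a:A$, $x:\mathrm{Spec}(A)$ one writes $a(x)=x(a)$. A Zariski-cover of $\mathrm{Spec}(A)$ is a finite family of subtypes $U_i=\{x\mid f_i(x)\text{ invertible}\}$ with $f_1,\dots,f_n:A$ generating the unit ideal. Axioms: (Locality) $R$ is local: $1\neq 0$, and if $x+y$ is invertible then $x$ or $y$ is invertible. (Duality) For every finitely presented $R$-algebra $A$ the map $A\to(\mathrm{Spec}(A)\to R)$, $a\mapsto(\varphi\mapsto\varphi(a))$ is an isomorphism of $R$-algebras. (Zariski-local choice) For every finitely presented $R$-algebra $A$ and family $B$ of merely inhabited types over $\mathrm{Spec}(A)$, there merely exist a Zariski-cover $U_1,\dots,U_n$ of $\mathrm{Spec}(A)$ and dependent functions $s_i:(x:U_i)\to B(x)$. A proposition is open if it is merely of the form $r_1\neq 0\vee\dots\vee r_n\neq 0$ with $r_i:R$, and closed if merely of the form $r_1=0\wedge\dots\wedge r_n=0$. A subtype $U$ of a type $X$ is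 open if $x\in U$ is an open proposition for all $x:X$. An affine scheme is a type merely of the form $\mathrm{Spec}(A)$ with $A$ a finitely presented $R$-algebra; a scheme is a type that merely has a finite cover by open subtypes that are affine schemes. A closed proposition is dense (closed dense) if it is merely of the form $r_1=0\wedge\dots\wedge r_n=0$ with all $r_i$ nilpotent. A type $X$ is formally unramified if for every closed dense proposition $P$ the map $X\to X^P$ sending $x$ to the constant map is an embedding. A map between schemes is unramified if all its fibers are formally unramified. Let $\mathbb{D}(1)=\{\epsilon:R\mid\epsilon^2=0\}$. For a type $X$ and $x:X$, $T_x(X)=\{t:\mathbb{D}(1)\to X\mid t(0)=x\}$, and for $f:X\to Y$ the map $df_x:T_x(X)\to T_{f(x)}(Y)$ is given by post-composition with $f$. For schemes, tangent spaces are $R$-modules and $df_x$ is $R$-linear: $(rv)(\epsilon)=v(r\epsilon)$ and $(v+w)(\epsilon)=\psi_{v,w}(\epsilon,\epsilon)$, where $\psi_{v,w}$ is the unique pointed map from $\mathbb{D}(2)=\{(a,b):R^2\mid a^2=ab=b^2=0\}$ to $(X,x)$ restricting to $v$ and $w$ on the two axes. *)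

(* Defs.v *)
(** Synthetic algebraic geometry in the style of homotopy type theory, on top
    of Rocq's standard library (no MathComp: its algebraic structures carry a
    decidable equality and a choice operator, which no ring satisfying the
    duality axiom can have).

    Identity types are Rocq's [eq], propositional truncation is [inhabited],
    propositions are types with at most one element, and [A <-> B] between
    types is [iffT].  Uniqueness of identity proofs is nowhere assumed. *)

From Stdlib Require Import Ring Ring_theory Setoid Morphisms CRelationClasses.
From Stdlib Require Fin.

Set Implicit Arguments.
Unset Strict Implicit.

(** ** Propositions, equivalences, embeddings *)

Definition isProp (A : Type) : Type := forall x y : A, x = y.

Definition isSet (A : Type) : Type := forall x y : A, isProp (x = y).

Definition isContr (A : Type) : Type := {a : A & forall b : A, a = b}.

Definition fiber (A B : Type) (f : A -> B) (b : B) : Type := {a : A & f a = b}.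

Definition isEquiv (A B : Type) (f : A -> B) : Type :=
  forall b : B, isContr (fiber f b).

Definition Equiv (A B : Type) : Type := {f : A -> B & isEquiv f}.

Definition isInjective (A B : Type) (f : A -> B) : Type :=
  forall x y : A, f x = f y -> x = y.

Definition isSurjective (A B : Type) (f : A -> B) : Type :=
  forall b : B, inhabited (fiber f b).

Definition isEmbedding (A B : Type) (f : A -> B) : Type :=
  forall x y : A, isEquiv (fun p : x = y => f_equal f p).

(** The part of homotopy type theory which is not already part of Rocq:
    function extensionality and propositional extensionality (the consequences
    of univalence that are used), and the fact that [inhabited A] is the
    propositional truncation of [A], i.e. a proposition that eliminates into
    every proposition, also those that do not live in [Prop].
    Univalence for larger types is deliberately left out: it is not needed to
    state the definitions below ("of the form" is read up to equivalence), and
    it contradicts proof irrelevance for the [Prop]-valued [eq]. *)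
Record Foundations : Type := {
  funext : forall (A : Type) (B : A -> Type) (f g : forall x, B x),
    (forall x, f x = g x) -> f = g;
  propext : forall P Q : Prop, isProp P -> isProp Q -> (P <-> Q) -> P = Q;
  trunc_isProp : forall A : Type, isProp (inhabited A);
  trunc_elim : forall P : Type, isProp P -> inhabited P -> P
}.

Lemma trunc_rec (fd : Foundations) (A P : Type) :
  isProp P -> (A -> P) -> inhabited A -> P.
Proof.
  intros hP h a. apply (trunc_elim fd hP). destruct a as [a]. exact (inhabits (h a)).
Defined.

Lemma isProp_forall (fd : Foundations) (A : Type) (B : A -> Type) :
  (forall x, isProp (B x)) -> isProp (forall x, B x).
Proof. intros h f g. apply (funext fd). intro x. apply h. Qed.

Lemma isProp_isProp (fd : Foundations) (A : Type) : isProp (isProp A).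
Proof.
  intros h k.
  assert (s : isSet A).
  { intros x y.
    assert (e : forall (z : A) (p : x = z), p = eq_trans (eq_sym (h x x)) (h x z)).
    { intros z []. destruct (h x x). reflexivity. }
    intros p q. rewrite (e y p), (e y q). reflexivity. }
  apply (funext fd). intro x. apply (funext fd). intro y. apply s.
Qed.

Lemma isSet_of_rel (A : Type) (E : A -> A -> Type) :
  (forall x y, isProp (E x y)) -> (forall x, E x x) ->
  (forall x y, E x y -> x = y) -> isSet A.
Proof.
  intros hp hr he x y.
  assert (e : forall (z : A) (p : x = z),
    p = eq_trans (eq_sym (he x x (hr x))) (he x z (eq_rect x (E x) (hr x) z p))).
  { intros z []. simpl. destruct (he x x (hr x)). reflexivity. }
  intros p q. rewrite (e y p), (e y q).
  rewrite (hp x y (eq_rect x (E x) (hr x) y p) (eq_rect x (E x) (hr x) y q)).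
  reflexivity.
Qed.

Lemma sigT_eq_prop (A : Type) (B : A -> Type) :
  (forall x, isProp (B x)) ->
  forall u v : {x : A & B x}, projT1 u = projT1 v -> u = v.
Proof.
  intros h [x b] [y c] p. simpl in p. subst y. rewrite (h x b c). reflexivity.
Qed.

(** ** Set quotients, as types of equivalence classes *)

Definition eq_class (A : Type) (E : A -> A -> Prop) (a : A) : A -> Prop :=
  fun b => inhabited (E a b).

Definition quotient (A : Type) (E : A -> A -> Prop) : Type :=
  {S : A -> Prop & inhabited {a : A & eq_class E a = S}}.

Definition qclass (A : Type) (E : A -> A -> Prop) (a : A) : quotient E :=
  existT (fun S => inhabited {a : A & eq_class E a = S}) (eq_class E a)
    (inhabits (existT _ a eq_refl)).

Section Quotient.
Context (fd : Foundations) (A : Type) (E : A -> A -> Prop).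
Context (Eequiv : RelationClasses.Equivalence E).

Lemma qclass_surj : isSurjective (qclass E).
Proof.
  intros [S h]. apply (trunc_rec fd (trunc_isProp fd (A := _))) with (2 := h).
  intros [a p]. constructor. exists a.
  apply sigT_eq_prop; [intro; apply (trunc_isProp fd) | exact p].
Qed.

Lemma qclass_eq (a b : A) : E a b -> qclass E a = qclass E b.
Proof.
  intro e. apply sigT_eq_prop; [intro; apply (trunc_isProp fd) | simpl].
  apply (funext fd). intro c.
  apply (propext fd); try apply (trunc_isProp fd).
  split; intros [d]; constructor.
  - transitivity a; [symmetry; exact e | exact d].
  - transitivity b; assumption.
Qed.

Lemma qclass_effective (a b : A) : qclass E a = qclass E b -> inhabited (E a b).
Proof.
  intro p. assert (q := f_equal (fun u => projT1 u b) p). simpl in q.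
  change (eq_class E a b). rewrite q. constructor. reflexivity.
Qed.

Lemma quotient_isSet : isSet (quotient E).
Proof.
  assert (hS : forall (u : quotient E) (b : A), isProp (projT1 u b)).
  { intros [S h] b. simpl.
    apply (trunc_rec fd (isProp_isProp fd (A := S b))) with (2 := h).
    intros [a []]. apply (trunc_isProp fd). }
  apply (isSet_of_rel (E := fun u v : quotient E =>
    (forall b, projT1 u b -> projT1 v b) * (forall b, projT1 v b -> projT1 u b))%type).
  - intros u v [f g] [f' g']. f_equal; repeat (apply (funext fd); intro); apply hS.
  - intro u. split; auto.
  - intros u v [f g]. apply sigT_eq_prop; [intro; apply (trunc_isProp fd) |].
    apply (funext fd). intro b. apply (propext fd); try apply hS.
    split; [apply f | apply g].
Qed.

Lemma quotient_ind (P : quotient E -> Type) :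
  (forall u, isProp (P u)) -> (forall a, P (qclass E a)) -> forall u, P u.
Proof.
  intros hP h u. apply (trunc_rec fd (hP u)) with (2 := qclass_surj u).
  intros [a []]. apply h.
Qed.

Lemma quotient_rec_contr (B : Type) (sB : isSet B) (f : A -> B)
  (resp : forall a b, E a b -> f a = f b) (u : quotient E) :
  {z : B & forall a, qclass E a = u -> f a = z}.
Proof.
  apply (trunc_rec fd) with (3 := qclass_surj u).
  - intros [z h] [z' h']. apply sigT_eq_prop.
    + intro. apply (isProp_forall fd). intro. apply (isProp_forall fd). intro.
      apply sB.
    + simpl. apply (trunc_rec fd (sB z z')) with (2 := qclass_surj u).
      intros [a p]. rewrite <- (h a p). apply h'. exact p.
  - intros [a p]. exists (f a). intros b q.
    apply (trunc_rec fd (sB (f b) (f a)) (fun e => resp b a e)).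
    apply qclass_effective. rewrite p. exact q.
Defined.

Definition quotient_rec (B : Type) (sB : isSet B) (f : A -> B)
  (resp : forall a b, E a b -> f a = f b) (u : quotient E) : B :=
  projT1 (quotient_rec_contr sB resp u).

Lemma quotient_rec_class (B : Type) (sB : isSet B) (f : A -> B)
  (resp : forall a b, E a b -> f a = f b) (a : A) :
  quotient_rec sB resp (qclass E a) = f a.
Proof.
  symmetry. exact (projT2 (quotient_rec_contr sB resp (qclass E a)) a eq_refl).
Qed.

Lemma quotient_map_resp (f : A -> A) (hf : Proper (respectful E E) f) (a b : A) :
  E a b -> qclass E (f a) = qclass E (f b).
Proof. intro e. apply qclass_eq. apply hf. exact e. Qed.

Definition quotient_map (f : A -> A) (hf : Proper (respectful E E) f) :
  quotient E -> quotient E :=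
  quotient_rec quotient_isSet (quotient_map_resp hf).

Lemma quotient_map_class (f : A -> A) (hf : Proper (respectful E E) f) (a : A) :
  quotient_map hf (qclass E a) = qclass E (f a).
Proof. exact (quotient_rec_class quotient_isSet (quotient_map_resp hf) a). Qed.

Lemma Proper_partial (f : A -> A -> A)
  (hf : Proper (respectful E (respectful E E)) f) (a : A) :
  Proper (respectful E E) (f a).
Proof. intros b c e. apply hf; [reflexivity | exact e]. Qed.

Lemma quotient_fun_isSet : isSet (quotient E -> quotient E).
Proof.
  apply (isSet_of_rel (E := fun g h : quotient E -> quotient E =>
    forall u, g u = h u)).
  - intros g h. apply (isProp_forall fd). intro u. apply quotient_isSet.
  - reflexivity.
  - intros g h. apply (funext fd).
Qed.

Lemma quotient_map2_resp (f : A -> A -> A)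
  (hf : Proper (respectful E (respectful E E)) f) (a b : A) :
  E a b -> quotient_map (Proper_partial hf a) = quotient_map (Proper_partial hf b).
Proof.
  intro e. apply (funext fd). refine (quotient_ind _ _).
  - intro. apply quotient_isSet.
  - intro c. rewrite !quotient_map_class. apply qclass_eq.
    apply hf; [exact e | reflexivity].
Qed.

Definition quotient_map2 (f : A -> A -> A)
  (hf : Proper (respectful E (respectful E E)) f) :
  quotient E -> quotient E -> quotient E :=
  quotient_rec quotient_fun_isSet (quotient_map2_resp hf).

Lemma quotient_map2_class (f : A -> A -> A)
  (hf : Proper (respectful E (respectful E E)) f) (a b : A) :
  quotient_map2 hf (qclass E a) (qclass E b) = qclass E (f a b).
Proof.
  unfold quotient_map2.
  rewrite (quotient_rec_class quotient_fun_isSet (quotient_map2_resp hf) a).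
  apply quotient_map_class.
Qed.

End Quotient.

(** ** Commutative rings and algebras *)

Record CommRing : Type := {
  ring_car :> Type;
  rzero : ring_car;
  rone : ring_car;
  radd : ring_car -> ring_car -> ring_car;
  rmul : ring_car -> ring_car -> ring_car;
  ropp : ring_car -> ring_car;
  ring_laws : ring_theory rzero rone radd rmul (fun x y => radd x (ropp y)) ropp eq;
  ring_isSet : isSet ring_car
}.

Arguments rzero {_}.
Arguments rone {_}.

Declare Scope sag_scope.
Delimit Scope sag_scope with sag.
Notation "0" := rzero : sag_scope.
Notation "1" := rone : sag_scope.
Notation "x + y" := (radd x y) : sag_scope.
Notation "x * y" := (rmul x y) : sag_scope.
Notation "- x" := (ropp x) : sag_scope.

Fixpoint rpow (R : CommRing) (r : R) (k : nat) : R :=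
  match k with O => 1%sag | S k => (r * rpow r k)%sag end.

Fixpoint rsum (R : CommRing) (n : nat) : (Fin.t n -> R) -> R :=
  match n with
  | O => fun _ => 0%sag
  | S n => fun a => (a Fin.F1 + rsum (fun i => a (Fin.FS i)))%sag
  end.

Definition isInvertible (R : CommRing) (r : R) : Type := {s : R & (r * s)%sag = 1%sag}.

Definition isNilpotent (R : CommRing) (r : R) : Prop :=
  inhabited {k : nat & rpow r k = 0%sag}.

Definition inIdeal (R : CommRing) (n : nat) (a : Fin.t n -> R) (r : R) : Prop :=
  inhabited {c : Fin.t n -> R & rsum (fun i => (c i * a i)%sag) = r}.

Record RingHom (A B : CommRing) : Type := {
  hom_fun :> A -> B;
  hom_one : hom_fun 1%sag = 1%sag;
  hom_add : forall x y, hom_fun (x + y)%sag = (hom_fun x + hom_fun y)%sag;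
  hom_mul : forall x y, hom_fun (x * y)%sag = (hom_fun x * hom_fun y)%sag
}.

Record Algebra (R : CommRing) : Type := {
  alg_ring :> CommRing;
  alg_struct : RingHom R alg_ring
}.

Record AlgHom (R : CommRing) (A B : Algebra R) : Type := {
  alg_hom :> RingHom A B;
  alg_hom_struct : forall r : R, alg_hom (alg_struct A r) = alg_struct B r
}.

Definition AlgIso (R : CommRing) (A B : Algebra R) : Type :=
  {f : AlgHom A B & isEquiv f}.

Definition base_algebra (R : CommRing) : Algebra R := {|
  alg_ring := R;
  alg_struct := {|
    hom_fun := fun r : R => r;
    hom_one := eq_refl;
    hom_add := fun _ _ => eq_refl;
    hom_mul := fun _ _ => eq_refl |} |}.

Definition Spec (R : CommRing) (A : Algebra R) : Type := AlgHom A (base_algebra R).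

Section QuotientRing.
Context (fd : Foundations) (T : Type) (z o : T)
  (ad mu : T -> T -> T) (op : T -> T) (E : T -> T -> Prop)
  (Ee : RelationClasses.Equivalence E) (Ex : ring_eq_ext ad mu op E)
  (Et : ring_theory z o ad mu (fun x y => ad x (op y)) op E).

Let qadd := quotient_map2 fd Ee (Radd_ext Ex).
Let qmul := quotient_map2 fd Ee (Rmul_ext Ex).
Let qopp := quotient_map fd Ee (Ropp_ext Ex).

Lemma quotient_ring_laws :
  ring_theory (qclass E z) (qclass E o) qadd qmul
    (fun x y => qadd x (qopp y)) qopp eq.
Proof.
  assert (Ha : forall a b, qadd (qclass E a) (qclass E b) = qclass E (ad a b))
    by apply quotient_map2_class.
  assert (Hm : forall a b, qmul (qclass E a) (qclass E b) = qclass E (mu a b))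
    by apply quotient_map2_class.
  assert (Hp : forall a, qopp (qclass E a) = qclass E (op a))
    by apply quotient_map_class.
  destruct Et.
  split; repeat (refine (quotient_ind fd _ _);
    [ intro; repeat (apply (isProp_forall fd); intro);
      apply (quotient_isSet fd (E := E)) | intro ]);
    rewrite ?Ha, ?Hm, ?Hp, ?Ha, ?Hm, ?Hp, ?Ha;
    try reflexivity; apply (qclass_eq fd Ee); auto.
Qed.

(** Quotient of a type with operations by a congruence modulo which it is a
    commutative ring. *)
Definition quotient_ring : CommRing := {|
  ring_car := quotient E;
  ring_laws := quotient_ring_laws;
  ring_isSet := quotient_isSet fd (E := E) |}.

End QuotientRing.

(** ** Polynomial algebras and finitely presented algebras

    [R[X_1,...,X_n]] is the free commutative [R]-algebra on [n] generators:
    polynomial expressions modulo the laws of commutative [R]-algebras. *)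

Inductive pexpr (R : Type) (n : nat) : Type :=
| PVar (i : Fin.t n)
| PConst (r : R)
| PAdd (p q : pexpr R n)
| PMul (p q : pexpr R n)
| POpp (p : pexpr R n).

Arguments PVar {R n} i.
Arguments PConst {R n} r.

Inductive peq (R : CommRing) (n : nat) : pexpr R n -> pexpr R n -> Prop :=
| peq_refl p : peq p p
| peq_sym p q : peq p q -> peq q p
| peq_trans p q s : peq p q -> peq q s -> peq p s
| peq_add p p' q q' : peq p p' -> peq q q' -> peq (PAdd p q) (PAdd p' q')
| peq_mul p p' q q' : peq p p' -> peq q q' -> peq (PMul p q) (PMul p' q')
| peq_opp p p' : peq p p' -> peq (POpp p) (POpp p')
| peq_add0 p : peq (PAdd (PConst 0%sag) p) p
| peq_addC p q : peq (PAdd p q) (PAdd q p)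
| peq_addA p q s : peq (PAdd p (PAdd q s)) (PAdd (PAdd p q) s)
| peq_addN p : peq (PAdd p (POpp p)) (PConst 0%sag)
| peq_mul1 p : peq (PMul (PConst 1%sag) p) p
| peq_mulC p q : peq (PMul p q) (PMul q p)
| peq_mulA p q s : peq (PMul p (PMul q s)) (PMul (PMul p q) s)
| peq_mulD p q s : peq (PMul (PAdd p q) s) (PAdd (PMul p s) (PMul q s))
| peq_constD r s : peq (PConst (r + s)%sag) (PAdd (PConst r) (PConst s))
| peq_constM r s : peq (PConst (r * s)%sag) (PMul (PConst r) (PConst s)).

Lemma peq_Equivalence (R : CommRing) (n : nat) :
  RelationClasses.Equivalence (@peq R n).
Proof.
  split; [exact (@peq_refl R n) | exact (@peq_sym R n) | exact (@peq_trans R n)].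
Qed.

Lemma peq_ext (R : CommRing) (n : nat) :
  ring_eq_ext (@PAdd R n) (@PMul R n) (@POpp R n) (@peq R n).
Proof.
  split; repeat intro; [apply peq_add | apply peq_mul | apply peq_opp]; assumption.
Qed.

Lemma peq_laws (R : CommRing) (n : nat) :
  ring_theory (PConst 0%sag) (PConst 1%sag) (@PAdd R n) (@PMul R n)
    (fun p q => PAdd p (POpp q)) (@POpp R n) (@peq R n).
Proof.
  split; intros; first [apply peq_add0 | apply peq_addC | apply peq_addA
    | apply peq_mul1 | apply peq_mulC | apply peq_mulA | apply peq_mulD
    | apply peq_addN | apply peq_refl].
Qed.

Definition poly_ring (fd : Foundations) (R : CommRing) (n : nat) : CommRing :=
  quotient_ring fd (peq_Equivalence R n) (peq_ext R n) (peq_laws R n).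

Definition poly_algebra (fd : Foundations) (R : CommRing) (n : nat) : Algebra R.
Proof.
  refine {| alg_ring := poly_ring fd R n;
    alg_struct := {| hom_fun := (fun r => qclass (@peq R n) (PConst r))
                       : R -> poly_ring fd R n |} |}.
  - reflexivity.
  - intros r s. simpl. rewrite quotient_map2_class.
    apply (qclass_eq fd (peq_Equivalence R n)). apply peq_constD.
  - intros r s. simpl. rewrite quotient_map2_class.
    apply (qclass_eq fd (peq_Equivalence R n)). apply peq_constM.
Defined.

Section IdealQuotient.
Context (fd : Foundations) (R : CommRing) (A : Algebra R) (n : nat) (a : Fin.t n -> A).

Add Ring A_ring : (ring_laws A).

Local Open Scope sag_scope.

Definition cong_mod (x y : A) : Prop := inIdeal a (x + - y).

Lemma inIdeal_add (x y : A) : inIdeal a x -> inIdeal a y -> inIdeal a (x + y).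
Proof.
  intros [[c hc]] [[d hd]]. constructor. exists (fun i => c i + d i).
  subst x y. clear. revert a c d. induction n as [|k IH]; intros a c d; simpl.
  - ring.
  - rewrite (IH (fun i => a (Fin.FS i)) (fun i => c (Fin.FS i))
      (fun i => d (Fin.FS i))). ring.
Qed.

Lemma inIdeal_mul (x y : A) : inIdeal a y -> inIdeal a (x * y).
Proof.
  intros [[c hc]]. constructor. exists (fun i => x * c i).
  subst y. clear. revert a c. induction n as [|k IH]; intros a c; simpl.
  - ring.
  - rewrite (IH (fun i => a (Fin.FS i)) (fun i => c (Fin.FS i))). ring.
Qed.

Lemma inIdeal_zero : inIdeal a 0.
Proof.
  constructor. exists (fun _ => 0).
  clear. revert a. induction n as [|k IH]; intros a; simpl.
  - ring.
  - rewrite (IH (fun i => a (Fin.FS i))). ring.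
Qed.

Lemma cong_mod_Equivalence : RelationClasses.Equivalence cong_mod.
Proof.
  split; unfold cong_mod.
  - intro x. replace (x + - x) with (0 : A) by ring. apply inIdeal_zero.
  - intros x y h. replace (y + - x) with (- (1) * (x + - y)) by ring.
    apply inIdeal_mul; exact h.
  - intros x y z h k. replace (x + - z) with ((x + - y) + (y + - z)) by ring.
    apply inIdeal_add; assumption.
Qed.

Lemma cong_mod_ext : ring_eq_ext (@radd A) (@rmul A) (@ropp A) cong_mod.
Proof.
  split; unfold cong_mod.
  - intros x x' h y y' k.
    replace (x + y + - (x' + y')) with ((x + - x') + (y + - y')) by ring.
    apply inIdeal_add; assumption.
  - intros x x' h y y' k.
    replace (x * y + - (x' * y')) with (y * (x + - x') + x' * (y + - y')) by ring.
    apply inIdeal_add; apply inIdeal_mul; assumption.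
  - intros x x' h. replace (- x + - - x') with (- (1) * (x + - x')) by ring.
    apply inIdeal_mul; exact h.
Qed.

Lemma cong_mod_laws :
  ring_theory 0 1 (@radd A) (@rmul A) (fun x y => x + - y) (@ropp A) cong_mod.
Proof.
  split; intros; unfold cong_mod;
    match goal with |- inIdeal _ ?e => replace e with (0 : A) by ring end;
    apply inIdeal_zero.
Qed.

Definition ideal_quotient_ring : CommRing :=
  quotient_ring fd cong_mod_Equivalence cong_mod_ext cong_mod_laws.

(** The [R]-algebra [A/(a_1,...,a_n)]. *)
Definition ideal_quotient : Algebra R.
Proof.
  refine {| alg_ring := ideal_quotient_ring;
    alg_struct := {| hom_fun := (fun r => qclass cong_mod (alg_struct A r))
                       : R -> ideal_quotient_ring |} |}.
  - simpl. f_equal. apply hom_one.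
  - intros r s. simpl. rewrite quotient_map2_class.
    f_equal. apply hom_add.
  - intros r s. simpl. rewrite quotient_map2_class.
    f_equal. apply hom_mul.
Defined.

End IdealQuotient.

Definition isFinitelyPresented (fd : Foundations) (R : CommRing) (A : Algebra R) : Prop :=
  inhabited {n : nat & {l : nat & {P : Fin.t l -> poly_algebra fd R n &
    AlgIso (ideal_quotient fd P) A}}}.

(** ** The axioms on the base ring *)

Definition isLocalRing (R : CommRing) : Type :=
  (((1%sag : R) <> 0%sag) *
   forall x y : R, isInvertible (x + y)%sag ->
     inhabited (isInvertible x + isInvertible y))%type.

Definition evaluation (R : CommRing) (A : Algebra R) : A -> (Spec A -> R) :=
  fun a x => x a.

(** The algebra structure on [Spec A -> R] is pointwise, so [evaluation] is a
    homomorphism by definition and an isomorphism exactly if it is an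
    equivalence. *)
Definition Duality (fd : Foundations) (R : CommRing) : Type :=
  forall A : Algebra R, isFinitelyPresented fd A -> isEquiv (@evaluation R A).

(** The subtype [{x | f(x) invertible}] of [Spec A]. *)
Definition basic_open (R : CommRing) (A : Algebra R) (f : A) : Type :=
  {x : Spec A & isInvertible (x f : R)}.

Definition ZariskiLocalChoice (fd : Foundations) (R : CommRing) : Type :=
  forall (A : Algebra R), isFinitelyPresented fd A ->
  forall B : Spec A -> Type, (forall x, inhabited (B x)) ->
  inhabited {n : nat & {f : Fin.t n -> A &
    (inIdeal f 1%sag *
     forall i, forall x : basic_open (f i), B (projT1 x))%type}}.

(** ** Open and closed propositions, schemes *)

Definition isOpenProp (R : CommRing) (P : Type) : Type :=
  (isProp P *
   inhabited {n : nat & {r : Fin.t n -> R &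
     iffT P (inhabited {i : Fin.t n & r i <> 0%sag})}})%type.

Definition isClosedDenseProp (R : CommRing) (P : Type) : Type :=
  (isProp P *
   inhabited {n : nat & {r : Fin.t n -> R &
     ((forall i, isNilpotent (r i)) *
      iffT P (forall i, r i = 0%sag))%type}})%type.

Definition isOpenSubtype (R : CommRing) (X : Type) (U : X -> Type) : Type :=
  forall x : X, isOpenProp R (U x).

Definition isAffine (fd : Foundations) (R : CommRing) (X : Type) : Prop :=
  inhabited {A : Algebra R & (isFinitelyPresented fd A * Equiv X (Spec A))%type}.

Definition isScheme (fd : Foundations) (R : CommRing) (X : Type) : Prop :=
  inhabited {n : nat & {U : Fin.t n -> X -> Type &
    ((forall i, isOpenSubtype R (U i)) *
     (forall x : X, inhabited {i : Fin.t n & U i x}) *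
     (forall i, isAffine fd R {x : X & U i x}))%type}}.

(** ** Unramified maps and differentials *)

Definition isFormallyUnramified (R : CommRing) (X : Type) : Type :=
  forall P : Type, isClosedDenseProp R P -> isEmbedding (fun (x : X) (_ : P) => x).

Definition isUnramified (R : CommRing) (X Y : Type) (f : X -> Y) : Type :=
  forall y : Y, isFormallyUnramified R (fiber f y).

(** The first-order infinitesimal disk [D(1)]. *)
Definition Disk (R : CommRing) : Type := {e : R & (e * e)%sag = 0%sag}.

Definition disk0 (R : CommRing) : Disk R.
Proof.
  exists 0%sag.
  abstract (rewrite <- (Radd_0_l (ring_laws R) (0 * 0)%sag),
    <- (Ropp_def (ring_laws R) (0 * 0)%sag) at 1;
    rewrite (Radd_comm (ring_laws R)), (Radd_assoc (ring_laws R)),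
      <- (Rdistr_l (ring_laws R)), (Radd_0_l (ring_laws R));
    apply (Ropp_def (ring_laws R))).
Defined.

Definition Tangent (R : CommRing) (X : Type) (x : X) : Type :=
  {t : Disk R -> X & t (disk0 R) = x}.

Definition differential (R : CommRing) (X Y : Type) (f : X -> Y) (x : X)
  (t : Tangent R x) : Tangent R (f x) :=
  existT (fun s : Disk R -> Y => s (disk0 R) = f x)
    (fun e => f (projT1 t e)) (f_equal f (projT2 t)).

(* Main.v *)
Require Import Defs.
From Stdlib Require Import CRelationClasses.
From Stdlib Require Import Ring Ring_theory.
From Stdlib Require Fin.

(** If [f] is unramified and two tangent vectors [s], [t] at [x] have the same
    image under [f], then for [e] in [D(1)] the points [s(e)] and [t(e)] lie in
    one fibre of [f] and agree as soon as the closed dense proposition [e = 0]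
    holds, hence agree.

    Conversely, let [f x = f x'] and suppose that [x = x'] holds under a closed
    dense hypothesis.  Removing nilpotents one at a time, each through its
    powers, reduces this hypothesis to [eps = 0] with [eps] of square zero
    ([nilpotents_reduction]).  Open propositions are stable under double
    negation and [eps = 0] is not false, so [x] and [x'] lie in one affine open
    subscheme of [X]; in coordinates, duality gives [x' = x + eps c] for some
    vector [c].  Where [u^2 = 0], a polynomial equation [P] satisfied by [x]
    holds at [x + u c] if and only if [u] kills the derivative of [P] at [x]
    along [c].  So [u |-> x + u c] is a map to [X] from the affine subscheme [L]
    of [R] cut out by [u^2 = 0] and the equations [u dP_x(c) = 0], and [L]
    contains every multiple of [eps].  The image of [L] under [f] stays in an
    affine open subscheme of [Y], because every point of [L] is infinitesimally
    close to [0].  By duality each coordinate of [f (x + u c)] is a polynomial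
    in [u], hence, as [u^2 = 0], of the form [s0 + u s1]; its values at [u = 0]
    and [u = eps] agree, so [eps s1 = 0], and [f (x + u eps c) = f x] for all
    [u].  Thus [u |-> x + u eps c] restricts to a tangent vector at [x] which
    [df_x] sends to zero.  Injectivity of [df_x] makes it constant, so that
    [u eps c = 0] for all [u] of square zero, which by duality forces
    [eps c = 0], that is [x = x'] ([separated_by_differential]).

    Besides locality, all that is used about [R] is duality for the algebras
    [R[X_1,...,X_n]/(P_1,...,P_l)], in the form of two statements about
    polynomial expressions: every function on the zeros of [P] is a polynomial
    ([functions_poly]), and a polynomial which vanishes on the zeros of [P] is
    in the ideal generated by [P] ([nullstellensatz]). *)

Set Implicit Arguments.
Unset Strict Implicit.

Local Open Scope sag_scope.

(** * Propositions and equivalences *)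

(** A [P : Prop] is a retract of the proposition [inhabited P], since
    eliminating a proof of [inhabited P] into [Prop] is always possible.  In
    particular identity types are propositions, and every type is a set. *)
Lemma proof_irrelevance (fd : Foundations) (P : Prop) : isProp P.
Proof.
  intros p q.
  exact (f_equal (fun h : inhabited P => match h with inhabits a => a end)
           (trunc_isProp fd (inhabits p) (inhabits q))).
Qed.

Lemma sigT_eq_Prop (fd : Foundations) (A : Type) (B : A -> Prop)
  (u v : {x : A & B x}) : projT1 u = projT1 v -> u = v.
Proof. apply sigT_eq_prop. intro. apply (proof_irrelevance fd). Qed.

Lemma isEmbedding_of_isInjective (fd : Foundations) (A B : Type) (f : A -> B) :
  isInjective f -> isEmbedding f.
Proof.
  intros h x y q. exists (existT _ (h x y q) (proof_irrelevance fd _ q)).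
  intro b. apply (sigT_eq_Prop fd). apply (proof_irrelevance fd).
Qed.

Section Inverse.
Context (A B : Type) (f : A -> B) (hf : isEquiv f).

Definition equiv_inv (b : B) : A := projT1 (projT1 (hf b)).

Lemma equiv_inv_r (b : B) : f (equiv_inv b) = b.
Proof. exact (projT2 (projT1 (hf b))). Qed.

Lemma equiv_inv_l (a : A) : equiv_inv (f a) = a.
Proof. exact (f_equal (@projT1 _ _) (projT2 (hf (f a)) (existT _ a eq_refl))). Qed.

Lemma equiv_inj (a a' : A) : f a = f a' -> a = a'.
Proof. intro p. rewrite <- (equiv_inv_l a), p. apply equiv_inv_l. Qed.

End Inverse.

Lemma isEquiv_id (A : Type) : isEquiv (fun a : A => a).
Proof.
  intro b. exists (existT (fun a => a = b) b eq_refl). intros [a []]. reflexivity.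
Qed.

Lemma finite_choice (n : nat) (B : Fin.t n -> Type) :
  (forall i, inhabited (B i)) -> inhabited (forall i, B i).
Proof.
  induction n as [|n IH]; intro h.
  - constructor. intro i. exact (Fin.case0 _ i).
  - destruct (h Fin.F1) as [b], (IH _ (fun i => h (Fin.FS i))) as [g].
    constructor. intro i. exact (Fin.caseS' i B b g).
Qed.

(** * Rings and homomorphisms *)

Section Homs.
Context (A B : CommRing) (h : RingHom A B).

Add Ring HA : (ring_laws A).
Add Ring HB : (ring_laws B).

Lemma hom_zero : h 0 = 0.
Proof.
  assert (e : h 0 = h 0 + h 0) by (rewrite <- hom_add; f_equal; ring).
  transitivity (h 0 + h 0 + - h 0); [| rewrite <- e]; ring.
Qed.

Lemma hom_opp (x : A) : h (- x) = - h x.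
Proof.
  assert (e : h (- x) + h x = 0).
  { rewrite <- hom_add, <- hom_zero. f_equal. ring. }
  transitivity (h (- x) + h x + - h x); [| rewrite e]; ring.
Qed.

Lemma hom_rsum (n : nat) (a : Fin.t n -> A) : h (rsum a) = rsum (fun i => h (a i)).
Proof.
  induction n as [|n IH]; simpl; [exact hom_zero |].
  rewrite hom_add, IH. reflexivity.
Qed.

End Homs.

Section RingFacts.
Context (A : CommRing).
Add Ring A_ring' : (ring_laws A).

Lemma rsum_zero (n : nat) (a : Fin.t n -> A) : (forall i, a i = 0) -> rsum a = 0.
Proof.
  induction n as [|n IH]; intro h; simpl; [reflexivity |].
  rewrite h, IH by (intro; apply h). ring.
Qed.

Lemma inIdeal_generator (n : nat) (a : Fin.t n -> A) (i : Fin.t n) :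
  inIdeal a (a i).
Proof.
  induction i as [n|n i IH].
  - constructor. exists (fun j => Fin.caseS' j (fun _ => A : Type) 1 (fun _ => 0)).
    simpl. rewrite rsum_zero by (intro; ring). ring.
  - destruct (IH (fun j => a (Fin.FS j))) as [[c e]].
    constructor. exists (fun j => Fin.caseS' j (fun _ => A : Type) 0 c).
    simpl. rewrite e. ring.
Qed.

Lemma eq_of_sub_zero (x y : A) : x + - y = 0 -> x = y.
Proof. intro e. transitivity (x + - y + y); [| rewrite e]; ring. Qed.

End RingFacts.

(** * Evaluation of polynomials *)

Section PolyClass.
Context (fd : Foundations) (R : CommRing) (n : nat).

Definition poly_class (p : pexpr R n) : poly_algebra fd R n := qclass (@peq R n) p.

Lemma poly_ind (Q : poly_algebra fd R n -> Prop) :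
  (forall p, Q (poly_class p)) -> forall x, Q x.
Proof.
  intro h. refine (quotient_ind fd _ h). intro. apply (proof_irrelevance fd).
Qed.

Lemma poly_class_add (p q : pexpr R n) :
  poly_class (PAdd p q) = poly_class p + poly_class q.
Proof. symmetry. apply quotient_map2_class. Qed.

Lemma poly_class_mul (p q : pexpr R n) :
  poly_class (PMul p q) = poly_class p * poly_class q.
Proof. symmetry. apply quotient_map2_class. Qed.

Lemma poly_class_opp (p : pexpr R n) : poly_class (POpp p) = - poly_class p.
Proof. symmetry. apply quotient_map_class. Qed.

End PolyClass.

Section Eval.
Context (R : CommRing) (B : Algebra R) (n : nat) (v : Fin.t n -> B).
Add Ring B_ring : (ring_laws B).

Fixpoint eval (p : pexpr R n) : B :=
  match p with
  | PVar i => v i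
  | PConst r => alg_struct B r
  | PAdd p q => eval p + eval q
  | PMul p q => eval p * eval q
  | POpp p => - eval p
  end.

Lemma eval_peq (p q : pexpr R n) : peq p q -> eval p = eval q.
Proof.
  induction 1; simpl; rewrite ?hom_zero, ?hom_one, ?hom_add, ?hom_mul;
    try congruence; ring.
Qed.

Context (fd : Foundations).

Definition poly_eval : poly_algebra fd R n -> B :=
  quotient_rec fd (peq_Equivalence R n) (ring_isSet (c := B)) eval_peq.

Lemma poly_eval_class (p : pexpr R n) : poly_eval (poly_class fd p) = eval p.
Proof. apply quotient_rec_class. Qed.

Definition poly_eval_hom : RingHom (poly_algebra fd R n) B.
Proof.
  refine {| hom_fun := poly_eval |}.
  - exact (eq_trans (poly_eval_class (PConst 1)) (hom_one (alg_struct B))).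
  - intro x. refine (poly_ind _). intro q. revert x. refine (poly_ind _). intro p.
    rewrite <- poly_class_add, !poly_eval_class. reflexivity.
  - intro x. refine (poly_ind _). intro q. revert x. refine (poly_ind _). intro p.
    rewrite <- poly_class_mul, !poly_eval_class. reflexivity.
Defined.

End Eval.

(** Naturality of evaluation; [taylor] applies it to the homomorphisms out of
    the dual numbers. *)
Lemma eval_hom (R : CommRing) (B C : Algebra R) (h : AlgHom B C) (n : nat)
  (v : Fin.t n -> B) (p : pexpr R n) : h (eval v p) = eval (fun i => h (v i)) p.
Proof.
  induction p; simpl; rewrite ?hom_add, ?hom_mul, ?hom_opp; try congruence.
  apply alg_hom_struct.
Qed.

(** * Spectra of presented algebras *)

Section Presented.
Context (fd : Foundations) (R : CommRing) (n l : nat) (P : Fin.t l -> pexpr R n).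

(** The points of [Spec (R[X_1,...,X_n]/(P_1,...,P_l))], through the mutually
    inverse maps [point] and [coords]. *)
Definition zeros (v : Fin.t n -> R) : Prop :=
  forall j, eval (B := base_algebra R) v (P j) = 0.

Let Pcl : Fin.t l -> poly_algebra fd R n := fun j => poly_class fd (P j).

Definition presented : Algebra R := ideal_quotient fd Pcl.

Definition mod_class (x : poly_algebra fd R n) : presented := qclass (cong_mod Pcl) x.

Definition pclass (p : pexpr R n) : presented := mod_class (poly_class fd p).

Lemma presented_ind (Q : presented -> Prop) :
  (forall x, Q (mod_class x)) -> forall a, Q a.
Proof.
  intro h. refine (quotient_ind fd _ h). intro. apply (proof_irrelevance fd).
Qed.

Lemma pclass_surj (a : presented) : exists p, pclass p = a.
Proof.
  revert a. refine (presented_ind _). refine (poly_ind _).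
  intro p. exists p. reflexivity.
Qed.

Add Ring R_ring0 : (ring_laws R).
Add Ring poly_ring0 : (ring_laws (poly_algebra fd R n)).

Lemma poly_eval_cong (v : Fin.t n -> R) (hv : zeros v) (x y : poly_algebra fd R n) :
  cong_mod Pcl x y ->
  poly_eval (B := base_algebra R) v x = poly_eval (B := base_algebra R) v y.
Proof.
  intros [[c e]]. apply (eq_of_sub_zero (A := R)).
  change (poly_eval_hom (B := base_algebra R) v fd x
    + - poly_eval_hom (B := base_algebra R) v fd y = 0).
  rewrite <- hom_opp, <- hom_add, <- e, hom_rsum. apply rsum_zero.
  intro j. rewrite hom_mul. simpl. unfold Pcl. rewrite poly_eval_class.
  rewrite (hv j). simpl. ring.
Qed.

Lemma mod_class_add (x y : poly_algebra fd R n) :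
  mod_class (x + y) = mod_class x + mod_class y.
Proof. symmetry. apply quotient_map2_class. Qed.

Lemma mod_class_mul (x y : poly_algebra fd R n) :
  mod_class (x * y) = mod_class x * mod_class y.
Proof. symmetry. apply quotient_map2_class. Qed.

Lemma mod_class_opp (x : poly_algebra fd R n) : mod_class (- x) = - mod_class x.
Proof. symmetry. apply quotient_map_class. Qed.

Definition point_fun (v : Fin.t n -> R) (hv : zeros v) : presented -> R :=
  quotient_rec fd (cong_mod_Equivalence Pcl) (ring_isSet (c := R)) (poly_eval_cong hv).

Lemma point_fun_class (v : Fin.t n -> R) (hv : zeros v) (x : poly_algebra fd R n) :
  point_fun hv (mod_class x) = poly_eval (B := base_algebra R) v x.
Proof. apply (quotient_rec_class fd (cong_mod_Equivalence Pcl) (ring_isSet (c := R)) (poly_eval_cong hv)). Qed.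

Definition point (v : Fin.t n -> R) (hv : zeros v) : Spec presented.
Proof.
  unshelve refine {| alg_hom := {| hom_fun := point_fun hv : presented -> base_algebra R |} |}.
  - refine (eq_trans (point_fun_class hv 1) _).
    exact (hom_one (poly_eval_hom (B := base_algebra R) v fd)).
  - intro x. refine (presented_ind _). intro y. revert x.
    refine (presented_ind _). intro x. rewrite <- mod_class_add, !point_fun_class.
    exact (hom_add (poly_eval_hom (B := base_algebra R) v fd) x y).
  - intro x. refine (presented_ind _). intro y. revert x.
    refine (presented_ind _). intro x. rewrite <- mod_class_mul, !point_fun_class.
    exact (hom_mul (poly_eval_hom (B := base_algebra R) v fd) x y).
  - intro r. refine (eq_trans (point_fun_class hv _) _).
    apply (poly_eval_class (B := base_algebra R) v fd (PConst r)).
Defined.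

Lemma point_class (v : Fin.t n -> R) (hv : zeros v) (p : pexpr R n) :
  point hv (pclass p) = eval (B := base_algebra R) v p.
Proof. exact (eq_trans (point_fun_class hv _) (poly_eval_class (B := base_algebra R) v fd p)). Qed.

Lemma eval_pclass (p : pexpr R n) : eval (fun i => pclass (PVar i)) p = pclass p.
Proof.
  induction p as [i|r|p IHp q IHq|p IHp q IHq|p IHp]; simpl eval;
    rewrite ?IHp, ?IHq; unfold pclass;
    rewrite ?poly_class_add, ?poly_class_mul, ?poly_class_opp,
      ?mod_class_add, ?mod_class_mul, ?mod_class_opp; reflexivity.
Qed.

Definition coords (x : Spec presented) : Fin.t n -> R := fun i => x (pclass (PVar i)).

Lemma eval_coords (x : Spec presented) (p : pexpr R n) :
  eval (B := base_algebra R) (coords x) p = x (pclass p).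
Proof. rewrite <- eval_pclass. symmetry. apply eval_hom. Qed.

Lemma zeros_coords (x : Spec presented) : zeros (coords x).
Proof.
  intro j. rewrite eval_coords.
  refine (eq_trans _ (hom_zero x)). f_equal.
  apply (qclass_eq fd (cong_mod_Equivalence Pcl)).
  unfold cong_mod.
  replace (poly_class fd (P j) + - _) with (Pcl j).
  - apply inIdeal_generator.
  - simpl. symmetry. change (Pcl j + - (0 : poly_algebra fd R n) = Pcl j). ring.
Qed.

End Presented.

(** * Dual numbers and derivatives *)

Section DualNumbers.
Context (fd : Foundations) (R : CommRing).
Add Ring R_ring1 : (ring_laws R).

Lemma dual_numbers_laws : ring_theory (0, 0) (1, 0)
  (fun a b : R * R => (fst a + fst b, snd a + snd b))
  (fun a b => (fst a * fst b, fst a * snd b + snd a * fst b))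
  (fun a b => (fst a + - fst b, snd a + - snd b))
  (fun a => (- fst a, - snd a)) eq.
Proof.
  split; repeat intros [? ?]; simpl; f_equal; ring.
Qed.

Definition dual_number_ring : CommRing := {|
  ropp := fun a : R * R => (- fst a, - snd a);
  ring_laws := dual_numbers_laws;
  ring_isSet := fun x y => proof_irrelevance fd (P := x = y) |}.

Definition dual_numbers : Algebra R.
Proof.
  unshelve refine {| alg_ring := dual_number_ring;
    alg_struct := {| hom_fun := (fun r => (r, 0)) : R -> dual_number_ring |} |};
    simpl; intros; f_equal; ring.
Defined.

(** The homomorphism [a + b e |-> a + b u], well defined because [u^2 = 0]. *)
Definition specialize (u : R) (hu : u * u = 0) : AlgHom dual_numbers (base_algebra R).
Proof.
  unshelve refine {| alg_hom := {| hom_fun :=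
    (fun a => fst a + u * snd a) : dual_numbers -> base_algebra R |} |}; simpl.
  - ring.
  - intros [a b] [c d]; simpl. ring.
  - intros [a b] [c d]; simpl.
    transitivity (a * c + u * (a * d + b * c) + (u * u) * (b * d)); [rewrite hu |]; ring.
  - intro r. ring.
Defined.

Definition dpoint (n : nat) (v c : Fin.t n -> R) : Fin.t n -> dual_numbers :=
  fun i => (v i, c i).

(** The second component of [p] evaluated in the dual numbers at [v + c e] is
    the derivative of [p] at [v] along [c].  Both sides are the image of this
    dual number under [e |-> u]; the case [u = 0] identifies its first
    component. *)
Lemma taylor (n : nat) (v c : Fin.t n -> R) (u : R) (hu : u * u = 0) (p : pexpr R n) :
  eval (B := base_algebra R) (fun i => v i + u * c i) p
  = eval (B := base_algebra R) v p + u * snd (eval (dpoint v c) p).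
Proof.
  assert (h0 : (0 : R) * 0 = 0) by ring.
  assert (e0 := eval_hom (specialize h0) (dpoint v c) p).
  assert (e := eval_hom (specialize hu) (dpoint v c) p).
  simpl in e, e0. rewrite <- e.
  replace (eval (B := base_algebra R) v p) with (fst (eval (dpoint v c) p)); [reflexivity |].
  transitivity (fst (eval (dpoint v c) p) + 0 * snd (eval (dpoint v c) p)); [ring |].
  rewrite e0. f_equal. apply (funext fd). intro i. ring.
Qed.

End DualNumbers.

(** * Consequences of duality and locality *)

Section Consequences.
Context (fd : Foundations) (R : CommRing) (R_local : isLocalRing R)
  (R_duality : Duality fd R).
Add Ring R_ring2 : (ring_laws R).

Lemma presented_isFinitelyPresented (n l : nat) (P : Fin.t l -> pexpr R n) :
  isFinitelyPresented fd (presented fd P).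
Proof.
  constructor. exists n, l, (fun j => poly_class fd (P j)).
  unshelve eexists {| alg_hom := {| hom_fun := (fun a => a) : _ -> presented fd P |} |};
    try reflexivity.
  apply isEquiv_id.
Qed.

(** Surjectivity in the duality axiom. *)
Lemma functions_poly (n l : nat) (P : Fin.t l -> pexpr R n)
  (h : forall v, zeros P v -> R) :
  exists G : pexpr R n, forall v hv, h v hv = eval (B := base_algebra R) v G.
Proof.
  assert (E := R_duality (presented_isFinitelyPresented P)).
  set (F := fun x : Spec (presented fd P) => h (coords x) (zeros_coords x)).
  destruct (pclass_surj (equiv_inv E F)) as [G e]. exists G. intros v hv.
  rewrite <- (point_class fd hv), e.
  change (h v hv = evaluation (equiv_inv E F) (point fd hv)).
  rewrite equiv_inv_r. unfold F.
  generalize (zeros_coords (point fd hv)).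
  replace (coords (point fd hv)) with v.
  - intro hv'. f_equal. apply (proof_irrelevance fd).
  - apply (funext fd). intro i. symmetry. apply (point_class fd hv (PVar i)).
Qed.

(** Injectivity in the duality axiom.  The resulting identity between
    polynomials is stated after evaluation in an arbitrary algebra, so that it
    can be specialized to the dual numbers as well as to [R]. *)
Lemma nullstellensatz (n l : nat) (P : Fin.t l -> pexpr R n) (G : pexpr R n) :
  (forall v, zeros P v -> eval (B := base_algebra R) v G = 0) ->
  exists c : Fin.t l -> poly_algebra fd R n,
    forall (B : Algebra R) (w : Fin.t n -> B),
      rsum (fun j => poly_eval (fd := fd) w (c j) * eval w (P j)) = eval w G.
Proof.
  intro h.
  assert (E := R_duality (presented_isFinitelyPresented P)).
  assert (e : pclass fd P G = pclass fd P (PConst 0)).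
  { apply (equiv_inj E). apply (funext fd). intro x. unfold evaluation.
    rewrite <- !eval_coords. rewrite h by apply zeros_coords. reflexivity. }
  destruct (qclass_effective (cong_mod_Equivalence _) e) as [[[c hc]]].
  exists c. intros B w.
  assert (e' := f_equal (poly_eval_hom w fd) hc).
  rewrite hom_rsum in e'.
  transitivity (eval w G + - eval w (PConst 0)).
  - refine (eq_trans _ (eq_trans e' _)).
    + f_equal. apply (funext fd). intro j. rewrite hom_mul. simpl.
      rewrite poly_eval_class. reflexivity.
    + rewrite hom_add, hom_opp. simpl.
      change (poly_eval w (poly_class fd G) + - poly_eval w (poly_class fd (PConst 0))
        = eval w G + - eval w (PConst 0)).
      rewrite !poly_eval_class. reflexivity.
  - simpl. rewrite hom_zero.
    rewrite (Radd_comm (ring_laws B)).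
    rewrite <- (Radd_0_l (ring_laws B) (- 0)), (Ropp_def (ring_laws B)).
    apply (Radd_0_l (ring_laws B)).
Qed.

Lemma invertible_summand (n : nat) (a : Fin.t n -> R) :
  isInvertible (rsum a) -> exists i, inhabited (isInvertible (a i)).
Proof.
  induction n as [|n IH]; simpl; intro h.
  - destruct h as [s e], (fst R_local). rewrite <- e. ring.
  - destruct (snd R_local _ _ h) as [[h1|h2]].
    + exists Fin.F1. constructor. exact h1.
    + destruct (IH _ h2) as [i hi]. exists (Fin.FS i). exact hi.
Qed.

(** The equations [r i = 0], between constants, define a closed subscheme of
    the point; a constant vanishing on it lies in the ideal of the [r i]. *)
Lemma inIdeal_of_zero (n : nat) (r : Fin.t n -> R) (a : R) :
  ((forall i, r i = 0) -> a = 0) -> inIdeal r a.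
Proof.
  intro h.
  destruct (@nullstellensatz 0 n (fun i => PConst (r i)) (PConst a)) as [c e].
  - intros v hv. exact (h hv).
  - constructor. eexists.
    exact (e (base_algebra R) (fun i => Fin.case0 (fun _ => R : Type) i)).
Qed.

Lemma inIdeal_single (u a : R) : (u = 0 -> a = 0) -> exists c, a = u * c.
Proof.
  intro h. destruct (@inIdeal_of_zero 1 (fun _ => u) a) as [[c e]].
  - intro h'. exact (h (h' Fin.F1)).
  - exists (c Fin.F1). rewrite <- e. simpl. ring.
Qed.

(** By [inIdeal_of_zero] the [r i] generate the unit ideal, and in a local ring
    one summand of a combination equal to [1] is invertible. *)
Lemma some_invertible (n : nat) (r : Fin.t n -> R) :
  ~ (forall i, r i = 0) -> exists i, inhabited (isInvertible (r i)).
Proof.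
  intro h.
  destruct (@inIdeal_of_zero n r 1) as [[c e]].
  - intro h'. destruct (h h').
  - destruct (@invertible_summand n (fun i => c i * r i)) as [i [[s hs]]].
    + rewrite e. exists 1. ring.
    + exists i. constructor. exists (c i * s). rewrite <- hs. ring.
Qed.

Lemma invertible_nonzero (r : R) : isInvertible r -> r <> 0.
Proof.
  intros [s e] e0. apply (fst R_local). rewrite <- e, e0. ring.
Qed.

Lemma square_zero_not_not_zero (u : R) : u * u = 0 -> ~ u <> 0.
Proof.
  intros hu h.
  destruct (@some_invertible 1 (fun _ => u)) as [_ [[s e]]].
  - intro h'. exact (h (h' Fin.F1)).
  - apply h. transitivity (s * (u * u)); [| rewrite hu; ring].
    transitivity (u * s * u); [rewrite e |]; ring.
Qed.

(** If [P] is not false, then the elements whose non-vanishing defines it do not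
    all vanish, so that one of them is invertible. *)
Lemma open_stable (P : Type) : isOpenProp R P -> ~ (P -> False) -> P.
Proof.
  intros [hP h] nn. apply (trunc_rec fd hP) with (2 := h).
  intros [n [r [to from]]]. apply from.
  destruct (@some_invertible n r) as [i [hi]].
  - intro h0. apply nn. intro p. destruct (to p) as [[i hi]]. exact (hi (h0 i)).
  - constructor. exists i. exact (invertible_nonzero hi).
Qed.

(** [P] is stable under double negation, and [u = 0] is not false.  Applied to
    [P := U x] for an open subtype [U], this lets [x] move infinitesimally
    inside [U]. *)
Lemma open_infinitesimal (P : Type) (u : R) :
  isOpenProp R P -> u * u = 0 -> (u = 0 -> P) -> P.
Proof.
  intros hP hu h. apply (open_stable hP). intro np.
  apply (square_zero_not_not_zero hu). intro e. exact (np (h e)).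
Qed.

(** The polynomial [c X] vanishes on [X^2 = 0], hence is a multiple of [X^2];
    evaluating at the dual number [e] gives [c e = 0]. *)
Lemma disk_cancel (c : R) : (forall u : R, u * u = 0 -> u * c = 0) -> c = 0.
Proof.
  intro h.
  destruct (@nullstellensatz 1 1 (fun _ => PMul (PVar Fin.F1) (PVar Fin.F1))
    (PMul (PVar Fin.F1) (PConst c))) as [a e].
  - intros v hv. apply h. exact (hv Fin.F1).
  - assert (e' := f_equal snd (e (dual_numbers fd R) (fun _ => (0, 1)))).
    simpl in e'. transitivity (0 * 0 + 1 * c); [ring |]. rewrite <- e'. ring.
Qed.

(** * Charts of schemes *)

(** An affine scheme in coordinates: a bijection of [X] with the zeros of
    finitely many polynomials in some [R^dim]. *)
Record chart (X : Type) : Type := {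
  dim : nat;
  num_eqs : nat;
  eqs : Fin.t num_eqs -> pexpr R dim;
  coord : X -> Fin.t dim -> R;
  of_coord : forall v, zeros eqs v -> X;
  coord_zeros : forall x, zeros eqs (coord x);
  of_coord_coord : forall x h, of_coord (v := coord x) h = x;
  coord_of_coord : forall v h, coord (of_coord (v := v) h) = v
}.

Arguments eqs {X} c _.
Arguments coord {X} c _ _.
Arguments of_coord {X c v} _.
Arguments coord_zeros {X} c _ _.
Arguments of_coord_coord {X c} _ _.

Lemma coord_inj (X : Type) (C : chart X) (x x' : X) :
  coord C x = coord C x' -> x = x'.
Proof.
  intro e. rewrite <- (of_coord_coord x (coord_zeros C x)).
  generalize (coord_zeros C x). rewrite e. apply of_coord_coord.
Qed.

Lemma AlgHom_ext (A B : Algebra R) (f g : AlgHom A B) : (forall a, f a = g a) -> f = g.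
Proof.
  destruct f as [[f f1 fa fm] fs], g as [[g g1 ga gm] gs]; simpl. intro h.
  assert (e : f = g) by (apply (funext fd); exact h). destruct e.
  assert (e : f1 = g1) by apply (proof_irrelevance fd). destruct e.
  assert (e : fa = ga) by apply (proof_irrelevance fd). destruct e.
  assert (e : fm = gm) by apply (proof_irrelevance fd). destruct e.
  f_equal. apply (proof_irrelevance fd).
Qed.

Definition AlgIso_inv (A B : Algebra R) (f : AlgHom A B) (hf : isEquiv f) : AlgHom B A.
Proof.
  unshelve refine {| alg_hom := {| hom_fun := equiv_inv hf |} |}.
  - apply (equiv_inj hf). rewrite equiv_inv_r, hom_one. reflexivity.
  - intros x y. apply (equiv_inj hf). rewrite hom_add, !equiv_inv_r. reflexivity.
  - intros x y. apply (equiv_inj hf). rewrite hom_mul, !equiv_inv_r. reflexivity.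
  - intro r. simpl. apply (equiv_inj hf).
    rewrite equiv_inv_r, alg_hom_struct. reflexivity.
Defined.

Definition AlgHom_comp (A B C : Algebra R) (g : AlgHom B C) (f : AlgHom A B) :
  AlgHom A C.
Proof.
  unshelve refine {| alg_hom := {| hom_fun := fun a => g (f a) |} |}.
  - rewrite !hom_one. reflexivity.
  - intros. rewrite !hom_add. reflexivity.
  - intros. rewrite !hom_mul. reflexivity.
  - intro. simpl. rewrite !alg_hom_struct. reflexivity.
Defined.

Lemma affine_chart (X : Type) : isAffine fd R X -> inhabited (chart X).
Proof.
  intros [[A [[[n [l [P0 [j hj]]]]] [e he]]]].
  (* The generators of the ideal are polynomials up to the laws of algebras;
     finite choice represents them by expressions. *)
  assert (hP : exists P : Fin.t l -> pexpr R n, (fun i => poly_class fd (P i)) = P0).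
  { destruct (@finite_choice l (fun i => {p | poly_class fd p = P0 i})) as [g].
    - intro i. generalize (P0 i). refine (poly_ind _). intro p. constructor.
      exists p. reflexivity.
    - exists (fun i => proj1_sig (g i)). apply (funext fd). intro i.
      exact (proj2_sig (g i)). }
  destruct hP as [P eP]. subst P0. change (AlgHom (presented fd P) A) in j.
  constructor.
  refine {| eqs := P;
    coord := fun x => coords (AlgHom_comp (e x) j);
    of_coord := fun v hv => equiv_inv he (AlgHom_comp (point fd hv) (AlgIso_inv hj)) |}.
  - intro x. apply zeros_coords.
  - intros x h. rewrite <- (equiv_inv_l he x) at 2. f_equal.
    apply AlgHom_ext. intro a. simpl.
    destruct (pclass_surj (equiv_inv hj a)) as [p ep].
    rewrite <- (equiv_inv_r hj a), equiv_inv_l, <- ep.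
    refine (eq_trans (point_class fd h p) _). rewrite eval_coords. reflexivity.
  - intros v hv. apply (funext fd). intro i. unfold coords. simpl.
    rewrite equiv_inv_r. simpl. rewrite equiv_inv_l.
    apply (point_class fd hv (PVar i)).
Qed.

Lemma scheme_chart (X : Type) (x : X) : isScheme fd R X ->
  inhabited {U : X -> Type & (isOpenSubtype R U * U x * chart {x : X & U x})%type}.
Proof.
  intros [[n [U [[hU cover] aff]]]]. destruct (cover x) as [[i hx]].
  destruct (affine_chart (aff i)) as [C].
  constructor. exists (U i). exact (hU i, hx, C).
Qed.

Lemma open_subtype_ext (X : Type) (U : X -> Type) : isOpenSubtype R U ->
  forall a b : {x : X & U x}, projT1 a = projT1 b -> a = b.
Proof. intro hU. apply sigT_eq_prop. intro x. exact (fst (hU x)). Qed.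

(** * Nearby points in a fibre *)

Lemma differential_eq (X Y : Type) (f : X -> Y) (x : X) (s t : Tangent R x) :
  (forall e, f (projT1 s e) = f (projT1 t e)) ->
  @differential R X Y f x s = @differential R X Y f x t.
Proof.
  intro h. apply (sigT_eq_Prop fd). apply (funext fd). exact h.
Qed.

Definition const_tangent (X : Type) (x : X) : Tangent R x :=
  existT (fun t : Disk R -> X => t (disk0 R) = x) (fun _ => x) eq_refl.

(** The difference [eps c] of the coordinates of [x'] and [x] is a tangent
    vector at [x]: the equations of [X] only force [eps] to kill the derivatives
    along [c], but then [u eps] kills them too, for every [u].  That [f x = f x']
    is used in the same way to see that this tangent vector is killed by
    [df_x]. *)
Lemma separated_by_differential (X Y : Type) (hX : isScheme fd R X)
  (hY : isScheme fd R Y) (f : X -> Y)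
  (hf : forall x : X, isInjective (@differential R X Y f x))
  (x x' : X) (eps : R) :
  f x = f x' -> eps * eps = 0 -> (eps = 0 -> x = x') -> x = x'.
Proof.
  intros efx heps near.
  destruct (scheme_chart x hX) as [[U [[hU Ux] C]]].
  destruct (scheme_chart (f x) hY) as [[V [[hV Vy] D]]].
  assert (Ux' : U x').
  { apply (open_infinitesimal (hU x') heps). intro e. rewrite <- (near e). exact Ux. }
  set (a := existT U x Ux). set (a' := existT U x' Ux').
  assert (hc : exists c : Fin.t (dim C) -> R, coord C a' = fun i => coord C a i + eps * c i).
  { destruct (@finite_choice (dim C) (fun i => {c | coord C a' i = coord C a i + eps * c})) as [g].
    - intro i. destruct (@inIdeal_single eps (coord C a' i + - coord C a i)) as [c e].
      + intro e. replace a' with a by (apply (open_subtype_ext hU); exact (near e)). ring.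
      + constructor. exists c. rewrite <- e. ring.
    - exists (fun i => proj1_sig (g i)). apply (funext fd). intro i.
      exact (proj2_sig (g i)). }
  destruct hc as [c hc].
  (* The derivatives at [x] along [c] of the equations of [X]. *)
  set (slope := fun j => snd (eval (dpoint fd (coord C a) c) (eqs C j))).
  (* Where [u^2 = 0], the equations of [X] at [x + u c] say that [u] kills the
     slopes. *)
  set (L := fun i : Fin.t (S (num_eqs C)) => Fin.caseS' i (fun _ => pexpr R 1)
     (PMul (PVar Fin.F1) (PVar Fin.F1)) (fun j => PMul (PVar Fin.F1) (PConst (slope j)))).
  assert (L_square : forall v, zeros L v -> v Fin.F1 * v Fin.F1 = 0).
  { intros v hv. exact (hv Fin.F1). }
  assert (L_line : forall v, zeros L v -> zeros (eqs C) (fun i => coord C a i + v Fin.F1 * c i)).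
  { intros v hv j. rewrite (taylor fd) by exact (L_square v hv).
    rewrite (coord_zeros C a j).
    assert (e : v Fin.F1 * slope j = 0) by exact (hv (Fin.FS j)).
    change (0 + v Fin.F1 * slope j = 0). rewrite e. ring. }
  set (line := fun v hv => of_coord (L_line v hv)).
  assert (line_eq : forall v hv b, coord C b = (fun i => coord C a i + v Fin.F1 * c i) ->
    line v hv = b).
  { intros v hv b e. unfold line. generalize (L_line v hv). rewrite <- e.
    apply of_coord_coord. }
  assert (line_V : forall v hv, V (f (projT1 (line v hv)))).
  { intros v hv. apply (open_infinitesimal (hV _) (L_square v hv)). intro e.
    rewrite (line_eq v hv a); [exact Vy |].
    apply (funext fd). intro i. rewrite e. ring. }
  set (image := fun v hv => existT V _ (line_V v hv)).
  (* A polynomial in [u] is affine where [u^2 = 0]. *)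
  assert (affine : forall k : Fin.t (dim D), exists s0 s1 : R, forall v hv,
    coord D (image v hv) k = s0 + v Fin.F1 * s1).
  { intro k. destruct (functions_poly (P := L) (fun v hv => coord D (image v hv) k)) as [G hG].
    exists (eval (B := base_algebra R) (fun _ => 0) G),
      (snd (eval (dpoint fd (fun _ => 0) (fun _ => 1)) G)).
    intros v hv. rewrite hG.
    refine (eq_trans _ (taylor fd _ _ (L_square v hv) G)). f_equal. apply (funext fd). intro i.
    refine (Fin.caseS' i (fun i => v i = 0 + v Fin.F1 * 1) _ _);
      [simpl; ring | apply Fin.case0]. }
  (* Comparing the equations at [x' = x + eps c] and at [x] shows that [eps],
     and with it each of its multiples, kills all slopes. *)
  assert (L_multiple : forall u : R, zeros L (fun _ => u * eps)).
  { intros u i. refine (Fin.caseS' i (fun i => eval _ (L i) = 0) _ _); simpl.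
    - transitivity (u * u * (eps * eps)); [| rewrite heps]; ring.
    - intro j.
      assert (e := coord_zeros C a' j). rewrite hc, (taylor fd) in e by exact heps.
      rewrite (coord_zeros C a j) in e. change (0 + eps * slope j = 0) in e.
      transitivity (u * (0 + eps * slope j)); [ring | rewrite e; ring]. }
  set (path := fun u => line _ (L_multiple u)).
  assert (path0 : path 0 = a).
  { apply line_eq. apply (funext fd). intro i. ring. }
  assert (path1 : path 1 = a').
  { apply line_eq. rewrite hc. apply (funext fd). intro i. ring. }
  assert (coord_path : forall u k, coord D (image _ (L_multiple u)) k = coord D (image _ (L_multiple 0)) k).
  { intros u k.
    (* [s0 + eps * s1 = s0], so [eps * s1 = 0]. *)
    assert (e : image _ (L_multiple 1) = image _ (L_multiple 0)).
    { apply (open_subtype_ext hV). simpl. fold (path 1) (path 0). rewrite path0, path1.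
      symmetry. exact efx. }
    destruct (affine k) as [s0 [s1 h]].
    assert (e' := f_equal (fun b => coord D b k) e). simpl in e'. rewrite !h in *.
    simpl in *. apply (eq_of_sub_zero (A := R)).
    transitivity (u * ((s0 + 1 * eps * s1) + - (s0 + 0 * eps * s1))); [ring |].
    rewrite e'. ring. }
  assert (f_path : forall u, f (projT1 (path u)) = f x).
  { intro u.
    assert (e : image _ (L_multiple u) = image _ (L_multiple 0)).
    { apply (coord_inj (C := D)). apply (funext fd). exact (coord_path u). }
    change (projT1 (image _ (L_multiple u)) = f (projT1 a)).
    rewrite e, <- path0. reflexivity. }
  set (t := existT (fun t : Disk R -> X => t (disk0 R) = x)
    (fun e => projT1 (path (projT1 e))) (f_equal (@projT1 _ _) path0) : Tangent R x).
  assert (et : t = const_tangent x).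
  { apply hf. apply differential_eq. intro e. apply f_path. }
  assert (hd : forall i, eps * c i = 0).
  { intro i. apply disk_cancel. intros u hu.
    assert (e := f_equal (fun s => projT1 s (existT _ u hu)) et). simpl in e.
    change (projT1 (path u) = projT1 a) in e. apply (open_subtype_ext hU) in e.
    assert (e' := f_equal (fun b => coord C b i) e). cbv beta in e'.
    unfold path, line in e'. rewrite coord_of_coord in e'.
    apply (eq_of_sub_zero (A := R)).
    transitivity ((coord C a i + u * eps * c i) + - coord C a i); [ring |].
    rewrite e'. ring. }
  change (projT1 a = projT1 a'). f_equal. apply (coord_inj (C := C)).
  rewrite hc. apply (funext fd). intro i. rewrite hd. ring.
Qed.

End Consequences.

(** * Reduction to square-zero elements *)

Section Nilpotents.
Context (R : CommRing) (Q : Prop)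
  (h : forall e : R, e * e = 0 -> (e = 0 -> Q) -> Q).
Add Ring R_ring3 : (ring_laws R).

(** If [r^(k+2) = 0] then [r^(k+1)] has square zero, so one may assume that
    [r^(k+1) = 0]; this descends to [r = 0]. *)
Lemma nilpotent_reduction :
  forall r : R, isNilpotent r -> (r = 0 -> Q) -> Q.
Proof.
  intros r [[k hk]] hr. revert hk.
  induction k as [|[|k] IH]; simpl; intro hk.
  - apply hr. transitivity (r * 1); [| rewrite hk]; ring.
  - apply hr. rewrite <- hk. ring.
  - apply (h (e := rpow r (S k))).
    + simpl. transitivity (r * (r * rpow r k) * rpow r k); [| rewrite hk]; ring.
    + exact IH.
Qed.

Lemma nilpotents_reduction :
  forall (n : nat) (r : Fin.t n -> R), (forall i, isNilpotent (r i)) ->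
    ((forall i, r i = 0) -> Q) -> Q.
Proof.
  intro n. induction n as [|n IH]; intros r nil hr.
  - apply hr. apply Fin.case0.
  - apply (nilpotent_reduction (nil Fin.F1)). intro e0.
    apply (IH (fun i => r (Fin.FS i)) (fun i => nil (Fin.FS i))). intro e.
    apply hr. intro i. exact (Fin.caseS' i (fun i => r i = 0) e0 e).
Qed.

End Nilpotents.

(** * Unramified maps *)

Theorem proposition3p2p1
  (fd : Foundations) (R : CommRing)
  (R_local : isLocalRing R)
  (R_duality : Duality fd R)
  (R_choice : ZariskiLocalChoice fd R)
  (X Y : Type) (hX : isScheme fd R X) (hY : isScheme fd R Y) (f : X -> Y) :
  iffT (isUnramified R f)
       (forall x : X, isInjective (@differential R X Y f x)).
Proof.
  split.
  - intros unram x s t est. apply (sigT_eq_Prop fd). apply (funext fd). intro e.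
    assert (hf : forall d, f (projT1 s d) = f (projT1 t d)).
    { intro d. exact (f_equal (fun q => projT1 q d) est). }
    assert (dense : isClosedDenseProp R (projT1 e = 0)).
    { split; [apply (proof_irrelevance fd) |]. constructor.
      exists 1%nat, (fun _ => projT1 e). split.
      - intros _. constructor. exists 2%nat. simpl.
        rewrite (Rmul_comm (ring_laws R) _ 1), (Rmul_1_l (ring_laws R)). apply (projT2 e).
      - split; [intros h _; exact h | intro h; exact (h Fin.F1)]. }
    (* [s(e)] and [t(e)], as points of the fibre of [f] over [f (t(e))]. *)
    set (p := existT (fun z => f z = f (projT1 t e)) (projT1 s e) (hf e)).
    set (q := existT (fun z => f z = f (projT1 t e)) (projT1 t e) eq_refl).
    change (projT1 p = projT1 q). f_equal.
    apply (equiv_inv (unram _ _ dense p q)). apply (funext fd). intro e0.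
    apply (sigT_eq_Prop fd). simpl.
    replace e with (disk0 R).
    + rewrite (projT2 s), (projT2 t). reflexivity.
    + symmetry. apply (sigT_eq_Prop fd). exact e0.
  - intros inj y P [_ dense]. apply (isEmbedding_of_isInjective fd).
    intros [x p] [x' p'] exx'. apply (sigT_eq_Prop fd). simpl.
    destruct dense as [[n [r [nil [_ zero_P]]]]].
    refine (nilpotents_reduction _ nil _).
    + intros e he.
      apply (separated_by_differential R_local R_duality hX hY inj); [| exact he].
      rewrite p. symmetry. exact p'.
    + intro h0.
      exact (f_equal (fun q => projT1 (q (zero_P h0))) exx').
Qed.
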